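(* Let $n,s,k$ be integers with $k\geq 2$, $s\geq 3$ and $n\geq sk+1$. Then the automorphism group of the graph $G(n,k,s)$ is the dihedral group $D_{2n}$ (acting naturally on $[n]$ viewed as the vertices of an $n$-cycle).
   Context: Let $[n]=\{1,\dots,n\}$. A subset $S\subseteq[n]$ is $s$-stable if for all distinct $i,j\in S$ we have $s\leq |i-j|\leq n-s$. $[n]^k_s$ denotes the family of $s$-stable $k$-element subsets of $[n]$. The graph $G(n,k,s)$ has vertex set $[n]$, and two distinct vertices $i,j$ are adjacent iff there is no $S\in[n]^k_s$ with $\{i,j\}\subseteq S$. $D_{2n}$ denotes the dihedral group of order $2n$, i.e. the group of permutations of $[n]$ generated by $i\mapsto i+1$ and $i\mapsto -i$ (arithmetic modulo $n$, with $n$ representing $0$). *)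

(* Defs.v *)
From mathcomp Require Import all_boot all_order all_algebra all_fingroup.

Set Implicit Arguments.
Unset Strict Implicit.
Unset Printing Implicit Defensive.

Import GroupScope.
Local Open Scope nat_scope.

(* Encoding: [n] = {1, ..., n} is represented by 'I_n = {0, ..., n-1}, the
   vertex n being represented by 0.  Stability is unaffected, since this turns
   |i - n| into n - |i - n| and the interval [s, n - s] is invariant under
   d |-> n - d. *)

Definition stable (n s : nat) (S : {set 'I_n}) : bool :=
  [forall i in S, forall j in S, (i != j) ==> (s <= `|i - j| <= n - s)].

Definition stable_sets (n k s : nat) : {set {set 'I_n}} :=
  [set S : {set 'I_n} | (#|S| == k) && stable s S].

Definition G (n k s : nat) : rel 'I_n :=
  fun i j => (i != j) &&
    ~~ [exists S in stable_sets n k s, [set i; j] \subset S].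

Definition graph_aut (T : finType) (e : rel T) : {set {perm T}} :=
  [set p : {perm T} | [forall x, forall y, e (p x) (p y) == e x y]].

Lemma graph_autP (T : finType) (e : rel T) (p : {perm T}) :
  reflect (forall x y, e (p x) (p y) = e x y) (p \in graph_aut e).
Proof.
rewrite inE; apply: (iffP forallP) => [h x y | h x].
  exact/eqP/(forallP (h x)).
by apply/forallP => y; apply/eqP.
Qed.

Lemma graph_aut_group_set (T : finType) (e : rel T) : group_set (graph_aut e).
Proof.
apply/group_setP; split=> [|p q /graph_autP hp /graph_autP hq].
  by apply/graph_autP => x y; rewrite !perm1.
by apply/graph_autP => x y; rewrite !permM hq hp.
Qed.

Canonical graph_aut_group (T : finType) (e : rel T) :=
  Group (graph_aut_group_set e).

Lemma opp_ord_subproof (n : nat) (i : 'I_n) : (n - i) %% n < n.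
Proof. by rewrite ltn_mod; case: n i => [[]|]. Qed.

Definition opp_ord (n : nat) (i : 'I_n) : 'I_n := Ordinal (opp_ord_subproof i).

Lemma opp_ordK (n : nat) : involutive (@opp_ord n).
Proof.
move=> i; apply: val_inj => /=.
case: (posnP i) => [i0 | i_gt0]; first by rewrite i0 subn0 modnn subn0 modnn.
have lt_in := ltn_ord i.
rewrite (@modn_small (n - i)) ?ltn_subrL ?i_gt0 ?(leq_trans _ lt_in) //.
by rewrite subKn ?modn_small // ltnW.
Qed.

Definition rotation (n : nat) : {perm 'I_n} := perm (@ordS_inj n).

Definition reflection (n : nat) : {perm 'I_n} := perm (inv_inj (@opp_ordK n)).

Definition dihedral (n : nat) : {group {perm 'I_n}} :=
  <<[set rotation n; reflection n]>>%G.

(* Main.v *)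
(** Two vertices lie in a common stable [k]-set iff their difference modulo [n]
    lies in one of the blocks [[m * s, m * s + r]] with [0 < m < k], where
    [r = n - k * s]: the two arcs they cut out must have room for [m] and
    [k - m] arcs of length [s].  So [G] is the complement of the Cayley graph of
    [Z/n] whose connection set [D] is the union of the blocks, and it admits the
    dihedral symmetries.  Conversely, the number of [a] in [D] with [a - d] not
    in [D], for [d] the difference of two vertices, is preserved by every
    automorphism.  For [d = 1] only the left ends of the blocks count, so there
    are fewer than [k] such [a].  For [d] outside [D] and distinct from [0], [1]
    and [-1], each block contributes at least one [a] and some block at least
    two.  Hence automorphisms preserve the [n]-cycle.  When [s <= r + 1] the
    blocks merge into a single one, and the same count applies with [k = 2]. *)

Require Import Defs.
From mathcomp Require Import all_boot all_order all_algebra all_fingroup.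
From mathcomp Require Import zify.

Set Implicit Arguments.
Unset Strict Implicit.
Unset Printing Implicit Defensive.

Import GRing.Theory.
Local Open Scope nat_scope.

Lemma card_imset_ltn (aT rT : finType) (f : aT -> rT) (A : {set aT}) x y :
  x \in A -> y \in A -> x != y -> f x = f y -> #|f @: A| < #|A|.
Proof.
move=> xA yA neq_xy fxy; rewrite ltn_neqAle leq_imset_card andbT.
by apply: contra neq_xy => /imset_injP f_inj; apply/eqP/f_inj.
Qed.

Lemma card_spaced (T : finType) (A : {set T}) (f : T -> nat) (s a b : nat) :
  {in A, forall x, a <= f x /\ f x + s <= b} ->
  {in A &, forall x y, x != y -> f x <= f y -> f x + s <= f y} ->
  #|A| * s <= b - a.
Proof.
case: (posnP s) => [->|s_gt0] f_range f_spaced; first by rewrite muln0.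
have ltn_div u v : u + s <= v -> u %/ s < v %/ s.
  by move=> /(leq_div2r s); rewrite divnDr // divnn s_gt0 addn1.
pose slot x := (f x - a) %/ s.
have slot_inj : {in A &, injective slot}.
  move=> x y xA yA; apply: contra_eq => neq_xy.
  wlog le_f : x y xA yA neq_xy / f x <= f y => [wlog_le|].
    case/orP: (leq_total (f x) (f y)) => [|le_f]; first exact: wlog_le.
    by rewrite eq_sym wlog_le // eq_sym.
  have [le_ax _] := f_range x xA; have := f_spaced x y xA yA neq_xy le_f.
  by move=> sep; rewrite neq_ltn ltn_div //; lia.
rewrite -leq_divRL // cardE -(size_map slot) -[leqRHS](size_iota 0).
apply: uniq_leq_size => [|_ /mapP[x + ->]].
  rewrite map_inj_in_uniq ?enum_uniq // => x y.
  by rewrite !mem_enum; apply: slot_inj.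
rewrite mem_enum mem_iota => /f_range[le_ax le_xb].
by rewrite ltn_div //; lia.
Qed.

(** * Rotations and reflections of [Z/n] *)

Lemma val_subZp (n : nat) (x y : 'I_n.+1) :
  (x - y)%R = (if y <= x then x - y else n.+1 + x - y) :> nat.
Proof.
rewrite /= modnDmr; have := ltn_ord x; have := ltn_ord y.
case: (leqP y x) => le_yx lt_y lt_x; last by rewrite modn_small; lia.
by rewrite addnBA 1?ltnW // addnC -addnBA // modnDl modn_small; lia.
Qed.

Lemma val_oppZp (n : nat) (x : 'I_n.+1) :
  (- x)%R = (if x == 0 :> nat then 0 else n.+1 - x) :> nat.
Proof. by rewrite -sub0r val_subZp /= leqn0; case: eqP => [->|]; lia. Qed.

Lemma Zp_affine (n : nat) (f : 'I_n.+2 -> 'I_n.+2) (c : 'I_n.+2) :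
  (forall x, f (x + 1) = f x + c)%R -> forall x, (f x = f 0 + c * x)%R.
Proof.
move=> fS x; rewrite -[x]natr_Zp; elim: (x : nat) => [|i IH].
  by rewrite mulr0 addr0.
by rewrite mulrSr fS IH mulrDr mulr1 addrA.
Qed.

Lemma rotationE (n : nat) (x : 'I_n.+2) : rotation _ x = (x + 1)%R.
Proof. by rewrite permE [RHS](@add_Zp_1 n.+2). Qed.

Lemma reflectionE (n : nat) (x : 'I_n.+1) : reflection _ x = (- x)%R.
Proof. by rewrite permE; apply: val_inj. Qed.

Lemma rotation_expE (n i : nat) (x : 'I_n.+2) :
  (rotation n.+2 ^+ i)%g x = (x + i%:R)%R.
Proof.
elim: i => [|i IH]; first by rewrite perm1 addr0.
by rewrite expgSr permM IH rotationE mulrSr addrA.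
Qed.

Lemma rotation_in_dihedral (n i : nat) : (rotation n ^+ i)%g \in dihedral n.
Proof. by apply/groupX/mem_gen; rewrite !inE eqxx. Qed.

Lemma reflection_in_dihedral (n : nat) : reflection n \in dihedral n.
Proof. by apply: mem_gen; rewrite !inE eqxx orbT. Qed.

Lemma translation_in_dihedral (n : nat) (p : {perm 'I_n.+2}) (a : 'I_n.+2) :
  (forall x, p x = a + x)%R -> p \in dihedral n.+2.
Proof.
move=> pE; rewrite -[p](_ : rotation n.+2 ^+ a = p)%g ?rotation_in_dihedral //.
by apply/permP => x; rewrite rotation_expE natr_Zp pE addrC.
Qed.

Lemma central_symmetry_in_dihedral
    (n : nat) (p : {perm 'I_n.+2}) (a : 'I_n.+2) :
  (forall x, p x = a - x)%R -> p \in dihedral n.+2.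
Proof.
move=> pE; rewrite -(groupMl _ (reflection_in_dihedral _)).
apply: (@translation_in_dihedral _ _ a) => x.
by rewrite permM reflectionE pE opprK.
Qed.

Lemma cycle_aut_in_dihedral (n : nat) (p : {perm 'I_n.+2}) : 0 < n ->
  (forall x, p (x + 1) - p x \in [:: 1; -1])%R -> p \in dihedral n.+2.
Proof.
move=> n_gt0 step_pm1; pose step x : 'I_n.+2 := (p (x + 1) - p x)%R.
have stepE x : (p (x + 1) = p x + step x)%R by rewrite [RHS]addrC subrK.
(* Opposite consecutive steps would give p (x + 2) = p x. *)
have no_fold x : (step x + step (x + 1) != 0)%R.
  rewrite /step addrC subrKA subr_eq0 (inj_eq perm_inj).
  rewrite -addrA -subr_eq0 addrAC subrr add0r -val_eqE /=.
  by rewrite !modn_small.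
have step_const x : step x = step 0%R.
  rewrite (@Zp_affine _ step 0%R) ?mul0r ?addr0 // => {}x.
  rewrite addr0; have := no_fold x.
  have := step_pm1 x; have := step_pm1 (x + 1)%R; rewrite -!/(step _) !inE.
  by move=> /orP[]/eqP-> /orP[]/eqP->; rewrite ?subrr ?addNr ?eqxx.
have pE := Zp_affine (fun x => etrans (stepE x) (congr1 _ (step_const x))).
have := step_pm1 0%R; rewrite -/(step _) !inE.
case/orP=> /eqP step0; rewrite step0 in pE.
  by apply: translation_in_dihedral => x; rewrite pE mul1r.
by apply: central_symmetry_in_dihedral => x; rewrite pE mulN1r.
Qed.

(** * Automorphisms of Cayley graphs of [Z/n] *)

Lemma eq_graph_aut (T : finType) (e f : rel T) :
  e =2 f -> graph_aut e = graph_aut f.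
Proof.
move=> ef; apply/setP => p.
by apply/graph_autP/graph_autP => pe x y; have := pe x y; rewrite !ef.
Qed.

Lemma graph_aut_compl (T : finType) (e : rel T) : irreflexive e ->
  graph_aut (fun x y => (x != y) && ~~ e x y) = graph_aut e.
Proof.
move=> e_irr; apply/setP => p.
apply/graph_autP/graph_autP => pe x y; last by rewrite pe (inj_eq perm_inj).
have := pe x y; rewrite (inj_eq perm_inj).
by case: eqVneq => [->|_ /negb_inj]; rewrite ?e_irr.
Qed.

Lemma card_nbrs_diff_aut (T : finType) (e : rel T) (p : {perm T}) (x y : T) :
  p \in graph_aut e ->
  #|[set z | e (p x) z & ~~ e (p y) z]| = #|[set z | e x z & ~~ e y z]|.
Proof.
move=> /graph_autP pe; rewrite -[RHS](card_imset _ (@perm_inj _ p)).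
apply: eq_card => z; rewrite -[z](permKV p) mem_imset; last exact: perm_inj.
by rewrite !inE !pe.
Qed.

Section CayleyGraph.

Variables (V : finZmodType) (D : {set V}).

Definition cayley : rel V := fun x y => (y - x)%R \in D.

Definition shift_loss (d : V) : {set V} := [set a in D | (a - d)%R \notin D].

Lemma card_nbrs_diff_cayley (x y : V) :
  #|[set z | cayley x z & ~~ cayley y z]| = #|shift_loss (y - x)%R|.
Proof.
rewrite -(card_imset _ (addIr (- x)%R)); apply: eq_card => a.
rewrite -[a](addrK x) (mem_imset _ _ (addIr (- x)%R)) !inE /cayley.
by rewrite opprB addrA subrK.
Qed.

Lemma card_shift_loss_aut (p : {perm V}) (x y : V) : p \in graph_aut cayley ->
  #|shift_loss (p y - p x)%R| = #|shift_loss (y - x)%R|.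
Proof. by move=> pA; rewrite -!card_nbrs_diff_cayley card_nbrs_diff_aut. Qed.

End CayleyGraph.

Section CayleyDihedral.

Variables (n : nat) (D : {set 'I_n.+2}).
Hypothesis D_opp : forall d, ((- d)%R \in D) = (d \in D).

Lemma dihedral_sub_graph_aut : dihedral n.+2 \subset graph_aut (cayley D).
Proof.
rewrite gen_subG; apply/subsetP => p; rewrite in_set2.
case/orP => /eqP->; apply/graph_autP => x y; rewrite /cayley.
  by rewrite !rotationE opprD addrACA subrr addr0.
by rewrite !reflectionE -opprD D_opp.
Qed.

Lemma graph_aut_cayley : 0 < n -> 1%R \notin D ->
  (forall d, d \notin D -> d \notin [:: 0; 1; -1]%R ->
     #|shift_loss D 1%R| < #|shift_loss D d|) ->
  graph_aut (cayley D) = dihedral n.+2.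
Proof.
move=> n_gt0 one_notin loss1_lt; apply/eqP.
rewrite eqEsubset dihedral_sub_graph_aut andbT.
apply/subsetP => p pA; apply: cycle_aut_in_dihedral => // x.
have step1 : (x + 1 - x = 1)%R by rewrite addrC addKr.
have := card_shift_loss_aut x (x + 1)%R pA; rewrite step1 => eq_loss.
have step_notin : (p (x + 1) - p x)%R \notin D.
  have /graph_autP/(_ x (x + 1)%R) := pA.
  by rewrite /cayley step1 => ->.
have step_neq0 : (p (x + 1) - p x != 0)%R.
  by rewrite subr_eq0 (inj_eq perm_inj) -subr_eq0 step1 oner_eq0.
apply: contraT => step_npm1.
have := loss1_lt _ step_notin; rewrite eq_loss ltnn; apply.
by rewrite inE (negPf step_neq0).
Qed.

End CayleyDihedral.

(** * Differences within stable sets *)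

Definition block (n k s m : nat) : {set 'I_n} :=
  [set d : 'I_n | m * s <= d <= m * s + (n - k * s)].

Definition gaps (n k s : nat) : {set 'I_n} :=
  \bigcup_(m < k | 0 < m) block n k s m.

Lemma gapsP (n k s : nat) (d : 'I_n) :
  reflect (exists2 m, 0 < m < k & m * s <= d <= m * s + (n - k * s))
          (d \in gaps n k s).
Proof.
apply: (iffP bigcupP) => [[m m_gt0]|[m /andP[m_gt0 lt_mk] d_m]].
  by rewrite inE => d_m; exists m; rewrite // m_gt0 ltn_ord.
by exists (Ordinal lt_mk); rewrite ?inE.
Qed.

Lemma opp_in_gaps (n k s : nat) (d : 'I_n.+1) : k * s <= n.+1 ->
  ((- d)%R \in gaps n.+1 k s) = (d \in gaps n.+1 k s).
Proof.
move=> le_ks; suff opp_gap (e : 'I_n.+1) :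
    e \in gaps n.+1 k s -> (- e)%R \in gaps n.+1 k s.
  by apply/idP/idP => /opp_gap //; rewrite opprK.
case/gapsP => m lt_mk e_m; apply/gapsP; rewrite val_oppZp; case: eqP => e0.
  by exists m; lia.
by exists (k - m); have := ltn_ord e; rewrite ?mulnBl; nia.
Qed.

Lemma gaps_ge (n k s : nat) (d : 'I_n) : d \in gaps n k s -> s <= d.
Proof. by case/gapsP => m; nia. Qed.

Lemma gaps_le (n k s : nat) (d : 'I_n) :
  k * s <= n -> d \in gaps n k s -> d + s <= n.
Proof. by move=> le_ks /gapsP[m]; nia. Qed.

Lemma gapsN_between (n k s i : nat) (d : 'I_n) :
  i * s + (n - k * s) < d < i.+1 * s -> d \notin gaps n k s.
Proof.
move=> d_i; apply/gapsP => -[m _ d_m].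
by case: (ltnP i m); nia.
Qed.

Lemma block_divn (n k s m : nat) (d : 'I_n) :
  k * s <= n < k.+1 * s -> d \in block n k s m -> d %/ s = m.
Proof.
rewrite inE => n_ks d_m; rewrite -(subnKC (proj1 (andP d_m))).
by rewrite divnMDl ?divn_small ?addn0 //; nia.
Qed.

Lemma gaps_merge (n k s : nat) : 1 < k -> 0 < s -> k.+1 * s <= n.+1 ->
  gaps n k s = gaps n 2 s.
Proof.
move=> k_gt1 s_gt0 le_ks; apply/setP => d.
apply/gapsP/gapsP => [[m m_k d_m]|[[|[|m]] //= _ d_1]].
  by exists 1; nia.
case: (leqP (k.-1 * s) d) => d_k; first by exists k.-1; nia.
have := leq_trunc_div d s; have := ltn_ceil d s_gt0 => lt_d le_d.
by exists (d %/ s); rewrite ?divn_gt0 ?ltn_divLR //; nia.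
Qed.

Lemma card_shift_loss_gaps_one (n k s : nat) : 0 < k -> 0 < s ->
  #|shift_loss (gaps n.+2 k s) 1%R| < k.
Proof.
move=> k_gt0 s_gt0; rewrite -[ltnRHS](prednK k_gt0) ltnS -[leqRHS]card_ord.
apply: leq_trans (leq_imset_card (fun m : 'I_k.-1 => inZp (m.+1 * s)) _).
apply/subset_leq_card/subsetP => a; rewrite inE => /andP[/gapsP[m lt_mk a_m]].
have a_gt0 : 0 < a by nia.
have pred_a : (a - 1)%R = a.-1 :> nat by rewrite val_subZp a_gt0 subn1.
move=> /gapsP-lost.
have aE : a = m * s :> nat.
  apply/eqP; apply: contra_notT lost => neq_a.
  by exists m => //; rewrite pred_a; lia.
have lt_m : m.-1 < k.-1 by lia.
apply/imsetP; exists (Ordinal lt_m) => //.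
by rewrite /= prednK -?aE ?valZpK //; lia.
Qed.

Lemma sub_block_starts (n k s i j : nat) (x y : 'I_n.+1) : k * s <= n.+1 ->
  i < k -> j < k -> x = i * s :> nat -> y = j * s :> nat -> x != y ->
  (x - y)%R \in gaps n.+1 k s.
Proof.
move=> le_ks lt_ik lt_jk xE yE; rewrite -val_eqE /= xE yE => neq_ij.
apply/gapsP; rewrite val_subZp xE yE; case: (leqP (j * s) (i * s)) => le_ji.
  by exists (i - j); rewrite ?mulnBl; nia.
by exists (k - (j - i)); rewrite ?mulnBl; nia.
Qed.

Section LargeShift.

Variables (n k s : nat) (d : 'I_n.+2).
Hypotheses (k_gt1 : 1 < k) (s_gt0 : 0 < s) (lt_ks : k * s < n.+2).
Hypothesis d_notin : d \notin gaps n.+2 k s.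

(* If [d <= n - s], shifting the first block above [d] brings its first two
   points into [[0, s)]; otherwise shifting the last block brings its last two
   points beyond [n - s]. *)
Lemma some_block_loses_consecutive : d \notin [:: 0; 1; -1]%R ->
  exists m c, [/\ 0 < m < k, m * s <= c < m * s + (n.+2 - k * s) &
    forall x : 'I_n.+2, c <= x <= c.+1 -> (x - d)%R \notin gaps n.+2 k s].
Proof.
rewrite !inE -!val_eqE /= !modn_small ?subSS ?subn0 // => d_far.
have d_lt := ltn_ord d.
case: (leqP (d + s) n.+2) => d_s.
  have lt_d : d < k.-1 * s.
    rewrite ltnNge; apply: contra d_notin => le_d.
    by apply/gapsP; exists k.-1; nia.
  exists (d %/ s).+1, ((d %/ s).+1 * s).
  have := leq_trunc_div d s; have := ltn_ceil d s_gt0.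
  set m := d %/ s => lt_ms le_ms; have lt_m : m.+1 < k by nia.
  split=> [||x x_c]; [lia|lia|apply/negP => /gaps_ge].
  rewrite val_subZp ifT; last by lia.
  have [m0|m_gt0] := posnP m; first by nia.
  have : m * s + (n.+2 - k * s) < d; last by nia.
  rewrite ltnNge; apply: contra d_notin => le_d.
  by apply/gapsP; exists m; lia.
exists k.-1, (n.+1 - s); split=> [||x x_c]; [lia|nia|].
apply/negP => /(gaps_le (ltnW lt_ks)); rewrite val_subZp leqNgt ifF ?negbF; nia.
Qed.

Lemma some_block_loses_two : d \notin [:: 0; 1; -1]%R ->
  exists2 m, 0 < m < k &
    1 < #|block n.+2 k s m :&: shift_loss (gaps n.+2 k s) d|.
Proof.
case/some_block_loses_consecutive => m [c [m_k c_m lost]]; exists m => //.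
have c_lt : c.+1 < n.+2 by nia.
have in_loss x : c <= x <= c.+1 ->
    inord x \in block n.+2 k s m :&: shift_loss (gaps n.+2 k s) d.
  move=> x_c; have xE : (inord x : 'I_n.+2) = x :> nat by rewrite inordK; lia.
  rewrite !inE xE lost ?xE // andbT; apply/andP; split; first by lia.
  by apply/gapsP; exists m; rewrite ?xE; lia.
apply/card_gt1P; exists (inord c), (inord c.+1).
split; [by apply: in_loss; lia..|].
by rewrite -val_eqE /= !inordK; lia.
Qed.

(* If the shifted start lay past the start of block [i], then the shift would
   send a later point of block [m] to the first point after block [i]. *)
Lemma shifted_block_start (m : nat) (start : 'I_n.+2) :
  n.+3 < k.+1 * s -> 0 < m < k -> start = m * s :> nat ->
  {in block n.+2 k s m, forall x, (x - d)%R \in gaps n.+2 k s} ->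
  exists2 i, i < k & (start - d)%R = i * s :> nat.
Proof.
move=> hole m_k startE block_shift.
have kept (x : 'I_n.+2) : m * s <= x <= m * s + (n.+2 - k * s) ->
    (x - d)%R \in gaps n.+2 k s.
  by move=> x_m; apply: block_shift; rewrite inE.
have /gapsP[i i_k shift_i] : (start - d)%R \in gaps n.+2 k s.
  by apply: kept; lia.
exists i; first by case/andP: i_k.
apply/eqP; rewrite eqn_leq (proj1 (andP shift_i)) andbT leqNgt.
apply/negP => start_past.
have [t t_le tE] : exists2 t,
    t <= n.+2 - k * s & t + (start - d)%R = i * s + (n.+2 - k * s).+1.
  exists (i * s + (n.+2 - k * s).+1 - (start - d)%R); first by lia.
  by apply: subnK; lia.
pose later : 'I_n.+2 := inord (m * s + t).
have laterE : later = m * s + t :> nat by rewrite inordK //; nia.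
have later_shiftE : (later - d)%R = i * s + (n.+2 - k * s).+1 :> nat.
  move: shift_i tE; rewrite !val_subZp startE laterE; have := ltn_ord d.
  by case: (leqP d (m * s)); case: (leqP d (m * s + t)); nia.
have /negP[] : (later - d)%R \notin gaps n.+2 k s.
  by apply: (@gapsN_between _ _ _ i); rewrite later_shiftE; lia.
by apply: kept; rewrite laterE; lia.
Qed.

Lemma each_block_loses_one (m : nat) :
  d != 0%R -> n.+3 < k.+1 * s -> 0 < m < k ->
  block n.+2 k s m :&: shift_loss (gaps n.+2 k s) d != set0.
Proof.
move=> d_neq0 hole m_k; apply: contraNneq d_notin => no_loss.
have kept : {in block n.+2 k s m, forall x, (x - d)%R \in gaps n.+2 k s}.
  move=> x x_m; apply: contraT => x_lost; rewrite -[false](in_set0 x) -no_loss.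
  rewrite !inE x_lost andbT; apply/andP; move: x_m; rewrite inE => x_m.
  by split=> //; apply/gapsP; exists m.
pose start : 'I_n.+2 := inord (m * s).
have startE : start = m * s :> nat by rewrite inordK //; nia.
have [i lt_ik shiftE] := shifted_block_start hole m_k startE kept.
rewrite -(subKr start d).
apply: (sub_block_starts (ltnW lt_ks) _ lt_ik startE shiftE).
  by case/andP: m_k.
by rewrite -subr_eq0 subKr.
Qed.

Lemma card_shift_loss_gaps_far : k = 2 \/ n.+3 < k.+1 * s ->
  d \notin [:: 0; 1; -1]%R -> k <= #|shift_loss (gaps n.+2 k s) d|.
Proof.
move=> k_or_hole d_far; have [m m_k two_lost] := some_block_loses_two d_far.
case: k_or_hole => [{1}->|hole].
  exact: leq_trans two_lost (subset_leq_card (subsetIr _ _)).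
have m_lt : m < k by case/andP: m_k.
case/card_gt1P: two_lost => a [b []] /setIP[a_m aL] /setIP[b_m bL] neq_ab.
pose blockof (c : 'I_n.+2) := insubd (Ordinal m_lt) (c %/ s).
have blockofE (i : 'I_k) c : c \in block n.+2 k s i -> blockof c = i.
  by move=> c_i; rewrite /blockof (block_divn _ c_i) ?valKd //; lia.
have same_block : blockof a = blockof b by rewrite !(blockofE (Ordinal m_lt)).
have k_gt0 : 0 < k by lia.
rewrite -[leqLHS](prednK k_gt0).
apply: leq_ltn_trans (card_imset_ltn aL bL neq_ab same_block).
rewrite -[X in X.-1]card_ord -(cardsC1 (Ordinal k_gt0)).
apply/subset_leq_card/subsetP => i; rewrite !inE -val_eqE /= -lt0n => i_gt0.
have i_k : 0 < i < k by rewrite i_gt0 /=.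
have [|c /setIP[c_i cL]] := set0Pn _ (each_block_loses_one _ hole i_k).
  by move: d_far; rewrite inE negb_or => /andP[].
by apply/imsetP; exists c; rewrite ?(blockofE i).
Qed.

End LargeShift.

(** * Stable sets through two given points *)

Lemma stableP (n s : nat) (S : {set 'I_n.+1}) :
  reflect (forall i j : 'I_n.+1, i \in S -> j \in S -> i != j -> s <= (j - i)%R)
          (stable s S).
Proof.
apply: (iffP forall_inP) => [S_st i j iS jS neq_ij|S_sep i iS].
  have /implyP/(_ neq_ij) := forall_inP (S_st i iS) j jS.
  by rewrite val_subZp; have := ltn_ord j; case: (leqP i j); lia.
apply/forall_inP => j jS; apply/implyP => neq_ij.
have := S_sep i j iS jS neq_ij; have := S_sep j i jS iS; rewrite eq_sym.
move=> /(_ neq_ij); rewrite !val_subZp; move: neq_ij; rewrite -val_eqE /=.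
have := ltn_ord i; have := ltn_ord j.
by case: (leqP i j); case: (leqP j i); lia.
Qed.

Section StableArcs.

Variables (n s : nat) (S : {set 'I_n.+1}) (i : 'I_n.+1).
Hypotheses (S_stable : stable s S) (iS : i \in S).

Lemma stable_spaced : {in S &, forall x y, x != y ->
  (x - i)%R <= (y - i)%R -> (x - i)%R + s <= (y - i)%R}.
Proof.
move=> x y xS yS neq_xy le_xy; have := stableP _ _ S_stable x y xS yS neq_xy.
have -> : (y - x = (y - i) - (x - i))%R by rewrite opprB addrA subrK.
by rewrite val_subZp le_xy leq_subRL.
Qed.

Lemma stable_spaced_end (x : 'I_n.+1) :
  s <= n.+1 -> x \in S -> (x - i)%R + s <= n.+1.
Proof.
move=> s_le xS; case: (eqVneq x i) => [->|neq_xi]; first by rewrite subrr.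
have := stableP _ _ S_stable x i xS iS neq_xi; rewrite !val_subZp.
move: neq_xi; rewrite -val_eqE /=; have := ltn_ord x.
by case: (leqP x i); case: (leqP i x); lia.
Qed.

End StableArcs.

Lemma stable_sub_in_gaps (n k s : nat) (S : {set 'I_n.+1}) (i j : 'I_n.+1) :
  k * s <= n.+1 -> S \in stable_sets n.+1 k s -> i \in S -> j \in S -> i != j ->
  (j - i)%R \in gaps n.+1 k s.
Proof.
rewrite inE => le_ks /andP[/eqP cardS S_stable] iS jS neq_ij.
pose pos (x : 'I_n.+1) : nat := (x - i)%R.
have pos_lt x : pos x < n.+1 := ltn_ord _.
have s_le : s <= n.+1.
  exact: leq_trans (stableP _ _ S_stable i j iS jS neq_ij) (ltnW (ltn_ord _)).
have spaced := stable_spaced S_stable : {in S &, forall x y, x != y ->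
  pos x <= pos y -> pos x + s <= pos y}.
pose A := [set x : 'I_n.+1 | pos x < pos j].
have card_before : #|S :&: A| * s <= pos j - 0.
  apply: (card_spaced (f := pos)) => [x|x y]; rewrite !inE.
    case/andP=> xS lt_xj; split=> //; apply: spaced; rewrite // 1?ltnW //.
    by apply: contraTneq lt_xj => ->; rewrite ltnn.
  by move=> /andP[xS _] /andP[yS _]; apply: spaced.
have card_after : #|S :\: A| * s <= n.+1 - pos j.
  apply: (card_spaced (f := pos)) => [x|x y]; rewrite !inE -!leqNgt.
    by case/andP=> le_jx xS; split; last exact: (stable_spaced_end S_stable iS).
  by move=> /andP[_ xS] /andP[_ yS]; apply: spaced.
have before_gt0 : 0 < #|S :&: A|.
  apply/card_gt0P; exists i; rewrite !inE iS /pos subrr lt0n.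
  by rewrite -[0]/(val (0%R : 'I_n.+1)) val_eqE subr_eq0 eq_sym.
have after_gt0 : 0 < #|S :\: A|.
  by apply/card_gt0P; exists j; rewrite !inE jS ltnn.
have := cardsID A S; rewrite cardS.
move: #|_ :&: _| #|_ :\: _| card_before card_after before_gt0 after_gt0.
move=> m l le_m le_l m_gt0 l_gt0 kE; apply/gapsP; exists m; first by lia.
by rewrite -kE mulnDl in le_ks *; have := pos_lt j; rewrite -/(pos j); lia.
Qed.

Lemma spaced_in_stable_sets (n k s : nat) (i : 'I_n.+1) (pos : nat -> nat) :
  0 < s -> {homo pos : t u / t < u >-> t + s <= u} ->
  (forall t, t < k -> pos t + s <= n.+1) ->
  [set (i + inord (pos t))%R | t : 'I_k] \in stable_sets n.+1 k s.
Proof.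
move=> s_gt0 pos_spaced pos_end; pose pt (t : 'I_k) := (i + inord (pos t))%R.
have val_pos (t : 'I_k) : (inord (pos t) : 'I_n.+1) = pos t :> nat.
  by rewrite inordK //; have := pos_end t (ltn_ord t); lia.
have pt_spaced t u : t != u -> s <= (pt u - pt t)%R.
  rewrite /pt opprD addrACA subrr add0r val_subZp !val_pos.
  rewrite -val_eqE /= neq_ltn => /orP[] /pos_spaced.
    by case: (leqP (pos t) (pos u)); lia.
  have := pos_end t (ltn_ord t).
  by case: (leqP (pos t) (pos u)); lia.
have pt_inj : injective pt.
  move=> t u eq_pt; case: (eqVneq t u) => // /pt_spaced.
  by rewrite eq_pt subrr leqNgt s_gt0.
rewrite inE card_imset // card_ord eqxx; apply/stableP.
move=> _ _ /imsetP[t _ ->] /imsetP[u _ ->].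
by rewrite (inj_eq pt_inj) => /pt_spaced.
Qed.

Lemma gap_in_stable (n k s : nat) (i j : 'I_n.+1) :
  0 < s -> k * s <= n.+1 -> (j - i)%R \in gaps n.+1 k s ->
  exists2 S, S \in stable_sets n.+1 k s & [set i; j] \subset S.
Proof.
move=> s_gt0 le_ks /gapsP[m m_k gap_m].
(* All steps have length [s], except that the one leading to the [m]-th point
   is stretched so as to reach [j]. *)
pose pos t := t * s + (m <= t) * ((j - i)%R - m * s).
exists [set (i + inord (pos t))%R | t : 'I_k].
  apply: spaced_in_stable_sets => // [t u lt_tu|t lt_tk]; rewrite /pos.
    by case: (leqP m t); case: (leqP m u); nia.
  by case: (leqP m t); nia.
have [k_gt0 lt_mk] : 0 < k /\ m < k by lia.
have mem_pos t (lt_tk : t < k) x : pos t = (x - i)%R ->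
    x \in [set (i + inord (pos t))%R | t : 'I_k].
  move=> pos_t; apply/imsetP; exists (Ordinal lt_tk) => //.
  by rewrite /= pos_t inord_val addrC subrK.
apply/subsetP => x; rewrite !inE => /orP[] /eqP->.
  by apply: (mem_pos _ k_gt0); rewrite /pos subrr /=; case: (leqP m); lia.
apply: (mem_pos _ lt_mk); rewrite /pos leqnn mul1n subnKC //.
by case/andP: gap_m.
Qed.

Lemma G_compl_cayley (n k s : nat) : 0 < s -> k * s <= n.+1 ->
  @G n.+1 k s =2 fun x y => (x != y) && ~~ cayley (gaps n.+1 k s) x y.
Proof.
move=> s_gt0 le_ks x y; rewrite /G /cayley; case: eqVneq => //= neq_xy.
congr (~~ _); apply/exists_inP/idP => [[S S_st /subsetP xyS]|gap_xy].
  by apply: (stable_sub_in_gaps le_ks S_st); rewrite ?xyS // !inE eqxx ?orbT.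
by have [S] := gap_in_stable s_gt0 le_ks gap_xy; exists S.
Qed.

Lemma graph_aut_cayley_gaps (n k s : nat) :
  1 < k -> 1 < s -> k * s < n.+2 -> k = 2 \/ n.+3 < k.+1 * s ->
  graph_aut (cayley (gaps n.+2 k s)) = dihedral n.+2.
Proof.
move=> k_gt1 s_gt1 lt_ks k_or_hole; have s_gt0 := ltnW s_gt1.
apply: graph_aut_cayley => [d|||d d_notin d_far]; last 1 first.
- have := card_shift_loss_gaps_far k_gt1 s_gt0 lt_ks d_notin k_or_hole d_far.
  exact: leq_trans (card_shift_loss_gaps_one _ (ltnW k_gt1) s_gt0).
- exact/opp_in_gaps/ltnW.
- by nia.
by apply/negP => /gaps_ge; rewrite /= modn_small //; lia.
Qed.

Theorem theorem4 (n s k : nat) (hk : 2 <= k) (hs : 3 <= s)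
    (hn : s * k + 1 <= n) :
  graph_aut (@G n k s) = dihedral n :> {set {perm 'I_n}}.
Proof.
case: n hn => [|[|n]] hn; [lia|nia|].
have s_gt0 : 0 < s by lia.
have lt_ks : k * s < n.+2 by lia.
have gaps_irr : irreflexive (cayley (gaps n.+2 k s)).
  move=> x; rewrite /cayley subrr; apply/negP => /gaps_ge.
  by rewrite leqNgt s_gt0.
rewrite (eq_graph_aut (G_compl_cayley s_gt0 (ltnW lt_ks))) graph_aut_compl //.
have [hole|merged] := ltnP n.+3 (k.+1 * s).
  by apply: graph_aut_cayley_gaps => //; [lia|right].
rewrite gaps_merge //; apply: graph_aut_cayley_gaps; [done|lia|nia|by left].
Qed.
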